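(* Let $d\ge2$. The set of alternatives $X\equiv\mathbb{R}_{++}^d$, endowed with the Euclidean topology, is locally compact, separable and completely metrizable. Define two relations on $\mathbb{R}_{++}^d$: $x\ggg y$ iff $\sum_{i=1}^k x_i>\sum_{i=1}^k y_i$ for every $k=1,\dots,d$; and $x>_{\mathrm{sym}}y$ iff there is a permutation $\sigma$ of $\{1,\dots,d\}$ such that $x_{\sigma(i)}>y_i$ for every $i$. Then the class $\mathcal{P}$ of all preferences on $X$ that are Grodal-transitive and strictly monotone with respect to $\ggg$ is a closed set (in the closed convergence topology) of locally strict preferences; and the same holds for the class of all preferences that are Grodal-transitive and strictly monotone with respect to $>_{\mathrm{sym}}$.
   Context: $\mathbb{R}_{++}=(0,\infty)$. A preference on $X$ is a complete binary relation on $X$ that is closed as a subset of $X\times X$; transitivity is not required. $x\succ y$ means $x\succeq y$ and not $y\succeq x$. $\succeq$ is locally strict if for all $x\succeq y$ and every neighborhood $V$ of $(x,y)$ in $X\times X$ there is $(x',y')\in V$ with $x'\succ y'$. $\succeq$ is Grodal-transitive if for all $x,y,z,w\in X$, $x\succeq y\succ z\succeq w$ implies $x\succeq w$. $\succeq$ is strictly monotone with respect to a relation $\rhd$ if $x\rhd y$ implies $x\succ y$. Closed convergence: $\succeq_n\to\succeq^*$ means (1) for all $x^*\succeq^* y^*$ there are $(x_n,y_n)\to(x^*,y^* )$ with $x_n\succeq_n y_n$ for all $n$; and (2) for every subsequence $\{\succeq_{n_k}\}_k$ and every limit $(x^*,y^* )$ of pairs with $x_{n_k}\succeq_{n_k}y_{n_k}$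 for all $k$, $x^*\succeq^*y^*$. For locally compact, separable, completely metrizable $X$ this is convergence in the metrizable closed convergence topology on continuous binary relations (closed subsets of $X\times X$). *)

(* Defs.v *)
From HB Require Import structures.
From mathcomp Require Import all_boot all_order all_algebra all_fingroup.
From mathcomp Require Import all_classical all_reals all_analysis.

Set Implicit Arguments.
Unset Strict Implicit.
Unset Printing Implicit Defensive.

Import Order.TTheory GRing.Theory Num.Theory.
Import numFieldNormedType.Exports.
Local Open Scope classical_set_scope.
Local Open Scope ring_scope.

Definition separable (X : topologicalType) : Prop :=
  exists2 D : set X, countable D & dense D.

Definition completely_metrizable (R : realType) (X : topologicalType) : Prop :=
  exists dist : X -> X -> R,
    [/\ (forall x y, dist x y = 0 <-> x = y),
        (forall x y, dist x y = dist y x),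
        (forall x y z, dist x z <= dist x y + dist y z),
        (forall (x : X) (A : set X), nbhs x A <->
           exists2 e : R, 0 < e & [set y | dist x y < e] `<=` A)
      & (forall u : nat -> X,
           (forall e : R, 0 < e -> exists N : nat, forall m n : nat,
              (N <= m)%N -> (N <= n)%N -> dist (u m) (u n) < e) ->
           exists l : X, u @ \oo --> l)].

(* Continuous binary relations: those whose graph is closed in [X * X]. *)
Record crel (X : topologicalType) := CRel {
  crel_rel :> X -> X -> Prop;
  crel_closed : closed [set p : X * X | crel_rel p.1 p.2] }.

Definition graph (X : topologicalType) (F : crel X) : set (X * X) :=
  [set p | F p.1 p.2].

(* The topology of closed convergence (Fell topology): the subbasic open sets
   are the relations missing a given compact set and those hitting a given
   open set. *)
Definition fell_subbase (X : topologicalType) : set_system (crel X) :=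
  [set [set F : crel X | graph F `&` K = set0] | K in [set K | compact K]] `|`
  [set [set F : crel X | graph F `&` U !=set0] | U in [set U | open U]].

HB.instance Definition _ (X : topologicalType) := gen_eqMixin (crel X).
HB.instance Definition _ (X : topologicalType) := gen_choiceMixin (crel X).
HB.instance Definition _ (X : topologicalType) :=
  isSubBaseTopological.Build (crel X) (@fell_subbase X) id.

Definition closed_convergence (X : topologicalType)
    (F_ : nat -> crel X) (F : crel X) : Prop :=
  (forall x y : X, F x y ->
     exists u v : nat -> X,
       [/\ u @ \oo --> x, v @ \oo --> y & forall n, F_ n (u n) (v n)]) /\
  (forall k : nat -> nat, {homo k : m n / (m < n)%N} ->
     forall (u v : nat -> X) (x y : X),
       u @ \oo --> x -> v @ \oo --> y ->
       (forall n, F_ (k n) (u n) (v n)) -> F x y).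

(* For [X] locally compact, separable and completely metrizable the topology
   above is metrizable with [closed_convergence] as its convergence of
   sequences, so that the two conjuncts are then the same requirement. *)
Definition closed_in_closed_convergence (X : topologicalType)
    (P : set (crel X)) : Prop :=
  closed P /\
  forall (F_ : nat -> crel X) (F : crel X),
    (forall n, P (F_ n)) -> closed_convergence F_ F -> P F.

(* Closedness of the graph is carried by [crel]; no transitivity is assumed. *)
Definition preference (X : topologicalType) (F : crel X) : Prop :=
  forall x y : X, F x y \/ F y x.

Definition strict (X : Type) (F : X -> X -> Prop) (x y : X) : Prop :=
  F x y /\ ~ F y x.

Definition locally_strict (X : topologicalType) (F : crel X) : Prop :=
  forall x y : X, F x y ->
    forall V : set (X * X), nbhs (x, y) V ->
      exists x' y' : X, V (x', y') /\ strict F x' y'.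

Definition grodal_transitive (X : Type) (F : X -> X -> Prop) : Prop :=
  forall x y z w : X, F x y -> strict F y z -> F z w -> F x w.

Definition strictly_monotone (X : Type) (gt F : X -> X -> Prop) : Prop :=
  forall x y : X, gt x y -> strict F x y.

Definition grodal_monotone_preferences (X : topologicalType)
    (gt : X -> X -> Prop) : set (crel X) :=
  [set F | [/\ preference F, grodal_transitive F & strictly_monotone gt F]].

Definition posvec (R : realType) (d : nat) : Type :=
  set_type [set x : 'rV[R]_d | forall i, 0 < x ord0 i].

(* The topology induced by that of ['rV[R]_d], i.e. the Euclidean one. *)
HB.instance Definition _ (R : realType) (d : nat) :=
  Topological.copy (posvec R d)
    (set_type [set x : 'rV[R]_d | forall i, 0 < x ord0 i]).

Definition coord (R : realType) (d : nat) (x : posvec R d) (i : 'I_d) : R :=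
  set_val x ord0 i.

Definition ggg (R : realType) (d : nat) (x y : posvec R d) : Prop :=
  forall k : 'I_d,
    \sum_(i < d | (i <= k)%N) coord y i < \sum_(i < d | (i <= k)%N) coord x i.

Definition gt_sym (R : realType) (d : nat) (x y : posvec R d) : Prop :=
  exists s : 'S_d, forall i : 'I_d, coord y i < coord x (s i).

(* Main.v *)
(* The only properties of the two dominance relations that matter are that they
   are open and contain pairs (y, x) and (x, z) with y and z arbitrarily close
   to x. In the limit [Fxy], [~ Fzy], [Fzw] are witnessed by nearby pairs of the
   approximating relations, completeness turns [~ Fzy] into strict preference,
   and Grodal transitivity is applied there.
   Positive vectors are homeomorphic to the whole space through the
   coordinatewise logarithm; the pulled-back norm metric is complete, unlike
   the Euclidean one. *)
Require Import Defs.
From mathcomp Require Import all_boot all_order all_algebra all_fingroup.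
From mathcomp Require Import all_classical all_reals all_analysis.
Local Open Scope classical_set_scope.

Set Implicit Arguments.
Unset Strict Implicit.
Unset Printing Implicit Defensive.

(** * Subbasic open sets and limits along subsequences *)

Lemma strict_of_not (X : topologicalType) (F : crel X) (x y : X) :
  preference F -> ~ F y x -> strict F x y.
Proof. by move=> /(_ x y)[] // Fxy nFyx; split. Qed.

Lemma open_fell_subbase (X : topologicalType) (A : set (crel X)) :
  fell_subbase A -> open A.
Proof.
move=> sA; exists [set A]; last by rewrite bigcup_set1.
by move=> _ ->; exact: (finI_from1 id sA).
Qed.

Lemma open_miss (X : topologicalType) (K : set (X * X)) :
  compact K -> open [set F : crel X | graph F `&` K = set0].
Proof. by move=> cK; apply: open_fell_subbase; left; exists K. Qed.

Lemma open_hit (X : topologicalType) (U : set (X * X)) :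
  open U -> open [set F : crel X | graph F `&` U !=set0].
Proof. by move=> oU; apply: open_fell_subbase; right; exists U. Qed.

Lemma extract_subsequence (P : nat -> Prop) :
  (forall N, exists2 n, (N <= n)%N & P n) ->
  exists2 k : nat -> nat, {homo k : m n / (m < n)%N} & forall n, P (k n).
Proof.
move=> infP; have /choice[f fP] : forall N, exists n, (N <= n)%N /\ P n.
  by move=> N; have [n] := infP N; exists n.
(* Each index is [f] at the successor of the previous one, hence strictly larger. *)
exists (fun n => iter n (f \o succn) (f 0%N)); last first.
  by case=> [|n]; exact: (fP _).2.
apply: homo_ltn => [? ? ?|n]; first exact: ltn_trans.
exact: (fP _).1.
Qed.

Lemma cvg_subsequence (X : topologicalType) (u : nat -> X) (x : X)
    (k : nat -> nat) :
  {homo k : m n / (m < n)%N} -> u @ \oo --> x -> (u \o k) @ \oo --> x.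
Proof.
move=> kP ux; apply: cvg_comp ux => A [N _ NA]; exists N => // n /= Nn.
apply: NA; apply: leq_trans Nn _ => /=.
by elim: n => // n IH; apply: leq_ltn_trans IH (kP _ _ (ltnSn n)).
Qed.

(** Restricting [u] and [v] to the infinitely many indices where the relation holds meets the
    subsequence clause of closed convergence. *)
Lemma closed_convergence_limsup (X : topologicalType) (F_ : nat -> crel X)
    (F : crel X) (u v : nat -> X) (x y : X) :
  closed_convergence F_ F -> u @ \oo --> x -> v @ \oo --> y ->
  (forall N, exists2 n, (N <= n)%N & F_ n (u n) (v n)) -> F x y.
Proof.
move=> [_ Fsup] ux vy /extract_subsequence[k kP kF].
exact: (Fsup k kP (u \o k) (v \o k)) (cvg_subsequence kP ux)
  (cvg_subsequence kP vy) kF.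
Qed.

(** Otherwise the relation would hold at arbitrarily late indices. This passes a failure in the
    limit on to the approximating relations. *)
Lemma closed_convergence_eventually_not (X : topologicalType)
    (F_ : nat -> crel X) (F : crel X) (u v : nat -> X) (x y : X) :
  closed_convergence F_ F -> u @ \oo --> x -> v @ \oo --> y -> ~ F x y ->
  \forall n \near \oo, ~ F_ n (u n) (v n).
Proof.
move=> FF ux vy; apply: contra_notP => nF.
apply: closed_convergence_limsup FF ux vy _ => N.
apply: contra_notP nF => nF; exists N => // n /= Nn Fn.
by apply: nF; exists n.
Qed.

(** * Abstract open dominance relations: local strictness and closedness *)

Section closed_class.
Variables (X : topologicalType) (gt : X -> X -> Prop).
Hypothesis gt_open : open [set p : X * X | gt p.1 p.2].
Hypothesis gt_above : forall x V, nbhs x V -> exists2 y, V y & gt y x.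
Hypothesis gt_below : forall x V, nbhs x V -> exists2 y, V y & gt x y.
Hypothesis compact_base : forall (x : X) U, nbhs x U ->
  exists2 K, nbhs x K & compact K /\ K `<=` U.

(* If y' >= x' with x' > x and y > y', then y' >= x' > x >= y forces y' >= y. *)
Lemma grodal_monotone_locally_strict :
  grodal_monotone_preferences gt `<=` [set F | locally_strict F].
Proof.
move=> F [Fpref Fgrodal Fmon] x y Fxy V [[A B] /= [xA yB] ABV].
have [x' Ax' x'x] := gt_above xA; have [y' By' yy'] := gt_below yB.
exists x', y'; split; first exact: ABV.
apply: strict_of_not => // Fy'x'.
have [_] := Fmon _ _ yy'; apply.
exact: Fgrodal Fy'x' (Fmon _ _ x'x) Fxy.
Qed.

(** Turns a failure of [F] into an open condition: missing a compact box defines a subbasic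
    neighbourhood of [F]. *)
Lemma compact_box_avoiding (F : crel X) (x y : X) : ~ F x y ->
  exists A B : set X, [/\ nbhs x A, nbhs y B & graph F `&` (A `*` B) = set0 /\
    compact (A `*` B)].
Proof.
move=> nF.
have : nbhs (x, y) (~` graph F) by apply: open_nbhs_nbhs; split=> //;
  exact/closed_openC/crel_closed.
move=> [[A B] /= [xA yB] ABF].
have [A' xA' [cA' sA']] := compact_base xA.
have [B' yB' [cB' sB']] := compact_base yB.
exists A', B'; split=> //; split; last exact: compact_setX.
rewrite -subset0 => -[a b] [Fab [/sA' Aa /sB' Bb]].
by apply: (ABF (a, b)) Fab.
Qed.

(** A two-point set is compact, so a relation leaving [x] and [y] incomparable has a neighbourhood
    of incomplete relations. *)
Lemma closed_preference : closed [set F : crel X | preference F].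
Proof.
move=> F Fcl x y; apply: contrapT => /not_orP[nxy nyx].
have cK : compact [set (x, y); (y, x)].
  by apply: compactU; exact: compact_set1.
have [|G [Gpref]] := Fcl [set G | graph G `&` [set (x, y); (y, x)] = set0].
  apply: open_nbhs_nbhs; split; first exact: open_miss.
  by rewrite /= -subset0 => p [+ [] e]; rewrite e.
rewrite /= -subset0 => Gmiss.
by case: (Gpref x y) => Gxy; [apply: (Gmiss (x, y))|apply: (Gmiss (y, x))];
  split=> //; [left|right].
Qed.

Lemma closed_grodal_monotone_preferences :
  closed (grodal_monotone_preferences gt).
Proof.
move=> F Fcl.
have Fpref : preference F.
  by apply: closed_preference; apply: closureS Fcl => G [].
split=> // [x y z w Fxy [Fyz nFzy] Fzw|x y xy].
  apply: contrapT => nFxw.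
  have [A [D [xA wD [FAD cAD]]]] := compact_box_avoiding nFxw.
  have [C [B [zC yB [FCB cCB]]]] := compact_box_avoiding nFzy.
  (* Members of [N] relate no point of [A] to one of [D] and none of [C] to one of [B], but some
     point of [A] to one of [B] and some point of [C] to one of [D]. *)
  pose N := [set G : crel X | graph G `&` (A `*` D) = set0] `&`
    [set G | graph G `&` (C `*` B) = set0] `&`
    [set G | graph G `&` (A `*` B)° !=set0] `&`
    [set G | graph G `&` (C `*` D)° !=set0].
  have NF : nbhs F N.
    apply: open_nbhs_nbhs; split.
      by do ![exact: open_miss|apply: open_hit; exact: open_interior|
              apply: openI].
    split; first split; first by split.
      by exists (x, y); split=> //; exists (A, B).
    by exists (z, w); split=> //; exists (C, D).
  have [G [[Gpref Ggrodal _] [[[GAD GCB] [[a b] [Gab GAB]]]]]] := Fcl N NF.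
  move=> [[c e] [Gce GCD]].
  have [Aa Bb] := interior_subset GAB.
  have [Cc De] := interior_subset GCD.
  (* Completeness of [G] puts [b] strictly above [c]; Grodal transitivity then relates [a] to [e],
     against the missed box. *)
  have : set0 (a, e); last by [].
  rewrite -GAD; split=> //; apply: Ggrodal Gab _ Gce.
  apply: strict_of_not => // Gcb.
  have : set0 (c, b); last by [].
  by rewrite -GCB; split.
apply: strict_of_not => // Fyx.
(* The graph of [F] meets the open set of reversed dominance pairs at [(y, x)], so some [G] of the
   class meets it too, against monotonicity. *)
have oU : open [set p : X * X | gt p.2 p.1].
  apply: (open_comp (f := fun p : X * X => (p.2, p.1))) gt_open => p _.
  by apply: cvg_pair; [exact: cvg_snd|exact: cvg_fst].
have [|G [[_ _ Gmon] [[a b] [Gab /= ba]]]] :=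
    Fcl [set G | graph G `&` [set p | gt p.2 p.1] !=set0].
  by apply: open_nbhs_nbhs; split; [exact: open_hit|exists (y, x)].
by have [_] := Gmon _ _ ba; apply.
Qed.

(** Sequences of witnesses replace the boxes of the topological argument. *)
Lemma limit_grodal_monotone_preferences (F_ : nat -> crel X) (F : crel X) :
  (forall n, grodal_monotone_preferences gt (F_ n)) ->
  closed_convergence F_ F -> grodal_monotone_preferences gt F.
Proof.
move=> PF FF; have [Finf _] := FF.
have Fpref : preference F.
  move=> x y; apply: contrapT => /not_orP[nxy nyx].
  have [n [+ +]] := filter_ex (filterI
    (closed_convergence_eventually_not FF (cvg_cst x) (cvg_cst y) nxy)
    (closed_convergence_eventually_not FF (cvg_cst y) (cvg_cst x) nyx)).
  by have [Pn _ _] := PF n; case: (Pn x y).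
split=> // [x y z w Fxy [Fyz nFzy] Fzw|x y xy].
  have [u [v [ux vy uv]]] := Finf _ _ Fxy.
  have [s [t [sz tw st]]] := Finf _ _ Fzw.
  have [M _ vs] := closed_convergence_eventually_not FF sz vy nFzy.
  apply: closed_convergence_limsup FF ux tw _ => N.
  (* From [M] on, [v n] is strictly preferred to [s n]; an index from [N] on is what has to be
     found. *)
  exists (maxn M N); first exact: leq_maxr.
  have [Pn Gn _] := PF (maxn M N).
  apply: Gn (uv _) _ (st _); apply: strict_of_not => //.
  by apply: vs => /=; exact: leq_maxl.
apply: strict_of_not => // Fyx.
have [v [u [vy ux vu]]] := Finf _ _ Fyx.
have uvxy : (fun n => (u n, v n)) @ \oo --> (x, y) by exact: cvg_pair.
have : \forall n \near \oo, gt (u n) (v n).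
  by apply: (uvxy [set p | gt p.1 p.2]); apply: open_nbhs_nbhs.
by move=> /filter_ex[n unvn]; have [_ _ /(_ _ _ unvn)[_]] := PF n; apply.
Qed.

End closed_class.

(** * Positive vectors in logarithmic coordinates *)

Section positive_vectors.
Import Order.TTheory GRing.Theory Num.Theory.
Import numFieldNormedType.Exports Defs.
Local Open Scope ring_scope.

(** A matrix neighbourhood contains a product of finitely many entry neighbourhoods. *)
Lemma cvg_mx (K : topologicalType) (m n : nat) (T : Type) (F : set_system T)
    (FF : Filter F) (f : T -> 'M[K]_(m, n)) (M : 'M[K]_(m, n)) :
  (forall i j, (fun t => f t i j) @ F --> M i j) -> f @ F --> M.
Proof.
move=> fM A [P MP sPA]; apply: (@filterS _ _ _ _ _ (fun t => sPA (f t))).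
by apply: filter_forall => i; apply: filter_forall => j; exact/fM/MP.
Qed.

Variables (R : realType) (d : nat).
Implicit Types (x y : posvec R d) (v : 'rV[R]_d).

Lemma coord_gt0 x i : 0 < coord x i.
Proof. exact: (set_valP x i). Qed.

Lemma coord_posvec_continuous i : continuous (fun x => coord x i).
Proof.
move=> x; apply: (@continuous_comp _ _ _ (@set_val _ _ : posvec R d -> 'rV[R]_d)
  (fun M : 'rV[R]_d => M ord0 i)).
  exact: initial_continuous.
exact: coord_continuous.
Qed.

Lemma posvec_inj x y : (forall i, coord x i = coord y i) -> x = y.
Proof. by move=> xy; apply/val_inj/rowP => i; exact: xy. Qed.

Lemma posvec_of_subproof (f : 'I_d -> R) : (forall i, 0 < f i) ->
  (\row_i f i) \in [set x : 'rV[R]_d | forall i, 0 < x ord0 i].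
Proof. by move=> f0; rewrite inE /= => i; rewrite mxE. Qed.

Definition posvec_of (f : 'I_d -> R) (f0 : forall i, 0 < f i) : posvec R d :=
  exist (fun x : 'rV[R]_d => x \in _) _ (posvec_of_subproof f0).

Lemma coord_posvec_of (f : 'I_d -> R) (f0 : forall i, 0 < f i) i :
  coord (posvec_of f0) i = f i.
Proof. by rewrite /coord set_valE /= mxE. Qed.

Definition lnv x : 'rV[R]_d := \row_i ln (coord x i).

Definition expv v : posvec R d := posvec_of (fun i => expR_gt0 (v ord0 i)).

Lemma coord_expv v i : coord (expv v) i = expR (v ord0 i).
Proof. exact: coord_posvec_of. Qed.

Lemma lnvK : cancel lnv expv.
Proof.
move=> x; apply: posvec_inj => i.
by rewrite coord_expv mxE lnK ?posrE ?coord_gt0.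
Qed.

Lemma expvK : cancel expv lnv.
Proof. by move=> v; apply/rowP => i; rewrite mxE coord_expv expRK. Qed.

Lemma lnv_continuous : continuous lnv.
Proof.
move=> x; apply: (cvg_mx (nbhs_filter x)) => i j; rewrite mxE.
under eq_fun do rewrite mxE.
apply: continuous_comp; first exact: coord_posvec_continuous.
exact/continuous_ln/coord_gt0.
Qed.

Lemma posvec_continuous (T : topologicalType) (f : T -> posvec R d) :
  (forall i, continuous (fun t => coord (f t) i)) -> continuous f.
Proof.
move=> fc; apply: continuous_comp_initial => t; apply: cvg_mx => i j.
by rewrite (ord1 i); exact: fc.
Qed.

Lemma expv_continuous : continuous expv.
Proof.
apply: posvec_continuous => i v; under eq_fun do rewrite coord_expv.
apply: continuous_comp; first exact: coord_continuous.
exact: continuous_expR.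
Qed.

(** The pullback of a closed norm ball around [lnv x] is closed as a preimage under [lnv] and
    compact as the image under [expv] of a bounded closed set. *)
Lemma posvec_closed_compact_base x U : nbhs x U ->
  exists2 K, nbhs x K & [/\ closed K, compact K & K `<=` U].
Proof.
move=> xU.
have : nbhs (lnv x) (expv @^-1` U) by apply: expv_continuous; rewrite lnvK.
move=> /nbhs_closedballP[r rU].
exists (lnv @^-1` closed_ball (lnv x) r%:num).
  apply: lnv_continuous; apply: filterS (@subset_closed_ball _ _ _ _) _.
  exact: nbhsx_ballx.
split.
- apply: closed_comp (@closed_ball_closed _ _ _ _) => y _.
  exact: lnv_continuous.
- have -> : lnv @^-1` closed_ball (lnv x) r%:num =
            expv @` closed_ball (lnv x) r%:num.
    by apply/seteqP; split=> [y By|_ [v Bv <-] /=]; [exists (lnv y)|];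
      rewrite ?lnvK ?expvK.
  apply: continuous_compact.
    by apply: continuous_subspaceT; exact: expv_continuous.
  apply: bounded_closed_compact; last exact: closed_ball_closed.
  exists (`|lnv x| + r%:num); split=> [|M rM v]; first exact: num_real.
  rewrite closed_ballE//= => xv; apply: le_trans (ltW rM).
  by rewrite -[v](subKr (lnv x)) (le_trans (ler_normB _ _))// lerD2l.
- by move=> y /rU; rewrite /= lnvK.
Qed.

Lemma posvec_compact_base x U : nbhs x U ->
  exists2 K, nbhs x K & compact K /\ K `<=` U.
Proof. by move=> /posvec_closed_compact_base[K xK [_ cK KU]]; exists K. Qed.

Lemma posvec_locally_compact : locally_compact [set: posvec R d].
Proof.
move=> x _; have [K xK [clK cK _]] :=
  posvec_closed_compact_base (@filterT _ _ (nbhs_filter x)).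
by exists K => //; exact: filterS xK.
Qed.

Lemma posvec_separable : separable (posvec R d).
Proof.
exists (range (fun q : 'rV[rat]_d => expv (map_mx ratr q))).
  by apply: sub_countable (card_image_le _ _) _; exact: countableP.
move=> O [x Ox] oO.
have : nbhs (lnv x) (expv @^-1` O).
  by apply: expv_continuous; rewrite lnvK; exact: open_nbhs_nbhs.
(* In logarithmic coordinates the open set contains a box; a rational is picked in each side. *)
move=> [P xP PO].
have /choice[q qP] : forall i, exists q : rat, P ord0 i (ratr q).
  move=> i.
  have Pi : (P ord0 i)° !=set0 by exists (lnv x ord0 i); exact: xP.
  have [r [Pr [q _ qr]]] := @dense_rat R _ Pi (open_interior (P ord0 i)).
  by exists q; rewrite qr; exact: interior_subset.
exists (expv (map_mx ratr (\row_i q i))); split; last by exists (\row_i q i).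
by apply: PO => i j; rewrite !mxE ord1; exact: qP.
Qed.

Lemma posvec_completely_metrizable : completely_metrizable R (posvec R d).
Proof.
exists (fun x y => `|lnv x - lnv y|); split.
- move=> x y; split=> [|->]; last by rewrite subrr normr0.
  by move=> /normr0_eq0/subr0_eq; exact: can_inj lnvK _ _.
- by move=> x y; exact: distrC.
- by move=> x y z; rewrite (le_trans _ (ler_normD _ _))// addrA subrK.
- move=> x A; split=> [xA|[e e0 sA]].
    have : nbhs (lnv x) (expv @^-1` A) by apply: expv_continuous; rewrite lnvK.
    move=> /nbhs_ballP[e e0 sA]; exists e => // y xy; rewrite -(lnvK y).
    by apply: sA; rewrite -ball_normE.
  have : nbhs x (lnv @^-1` ball (lnv x) e).
    by apply: lnv_continuous; exact: nbhsx_ballx.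
  by apply: filterS => y /=; rewrite -ball_normE => xy; exact: sA.
- move=> u uC.
  (* The logarithms form a Cauchy sequence in the complete space of row vectors; [expv] carries
     their limit back. *)
  have /cauchy_cvg/cvg_ex[l ul] : cauchy (lnv \o u @ \oo).
    apply/cauchy_ballP => e /uC[N NP]; rewrite !near_map2.
    exists ([set n | (N <= n)%N], [set n | (N <= n)%N]) => [|[m n] /= [Nm Nn]].
      by split; exists N.
    by rewrite -ball_normE; exact: NP.
  exists (expv l); rewrite -(_ : expv \o (lnv \o u) = u); last first.
    by apply/funext => n /=; rewrite lnvK.
  by apply: cvg_comp ul _; exact: expv_continuous.
Qed.

(** * Dominating and dominated points by dilation *)

Lemma dilate_gt0 x (t : R) i : 0 < expR t * coord x i.
Proof. by rewrite mulr_gt0 ?expR_gt0 ?coord_gt0. Qed.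

(** The exponential factor keeps the curve among positive vectors for every real [t], with all
    coordinates raised for [t > 0] and lowered for [t < 0]. *)
Definition dilate x (t : R) : posvec R d := posvec_of (dilate_gt0 x t).

Lemma dilate0 x : dilate x 0 = x.
Proof. by apply: posvec_inj => i; rewrite coord_posvec_of expR0 mul1r. Qed.

Lemma dilate_continuous x : continuous (dilate x).
Proof.
apply: posvec_continuous => i t; under eq_fun do rewrite coord_posvec_of.
by apply: cvgM; [exact: continuous_expR|exact: cvg_cst].
Qed.

Lemma near_dilate x V : nbhs x V -> \forall t \near 0, V (dilate x t).
Proof. by move=> xV; apply: dilate_continuous; rewrite dilate0. Qed.

Section dominance.
Variable gt : posvec R d -> posvec R d -> Prop.
Hypothesis gt_coord : forall x y, (forall i, coord y i < coord x i) -> gt x y.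

Lemma dominance_above x V : nbhs x V -> exists2 y, V y & gt y x.
Proof.
(* Half the radius is a positive parameter strictly inside the ball. *)
move=> /near_dilate/nbhs_ballP[e /= e0 eV]; exists (dilate x (e / 2)).
  apply: eV; rewrite /ball /= sub0r normrN gtr0_norm ?divr_gt0//.
  by rewrite gtr_pMr// invf_lt1// ltr1n.
apply: gt_coord => i; rewrite coord_posvec_of ltr_pMl ?coord_gt0//.
by rewrite expR_gt1 divr_gt0.
Qed.

Lemma dominance_below x V : nbhs x V -> exists2 y, V y & gt x y.
Proof.
move=> /near_dilate/nbhs_ballP[e /= e0 eV]; exists (dilate x (- (e / 2))).
  apply: eV; rewrite /ball /= sub0r opprK gtr0_norm ?divr_gt0//.
  by rewrite gtr_pMr// invf_lt1// ltr1n.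
apply: gt_coord => i; rewrite coord_posvec_of gtr_pMl ?coord_gt0//.
by rewrite expR_lt1 oppr_lt0 divr_gt0.
Qed.

Hypothesis gt_open : open [set p : posvec R d * posvec R d | gt p.1 p.2].

Lemma dominance_class :
  closed_in_closed_convergence (grodal_monotone_preferences gt) /\
  grodal_monotone_preferences gt `<=` [set F | locally_strict F].
Proof.
split; last exact: grodal_monotone_locally_strict dominance_above
  dominance_below.
split; first exact: closed_grodal_monotone_preferences gt_open
  posvec_compact_base.
by move=> F_ F; exact: limit_grodal_monotone_preferences.
Qed.

End dominance.

(** * Openness of the two dominance relations *)

Lemma near_lt_fun (T : topologicalType) (f g : T -> R) t :
  continuous f -> continuous g -> f t < g t -> \forall s \near t, f s < g s.
Proof.
move=> fc gc ftgt.
have gf : g s - f s @[s --> t] --> g t - f t.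
  exact: cvgB (gc t) (fc t).
have pos : \forall r \near g t - f t, 0 < r.
  by apply: open_nbhs_nbhs; split; [exact: open_gt|rewrite /= subr_gt0].
apply: (@filterS _ _ (nbhs_filter t)) (gf _ pos) => s.
by rewrite /= subr_gt0.
Qed.

Lemma coord_fst_continuous i :
  continuous (fun p : posvec R d * posvec R d => coord p.1 i).
Proof.
move=> p; apply: (@continuous_comp _ _ _ fst (fun x => coord x i)).
  exact: cvg_fst.
exact: coord_posvec_continuous.
Qed.

Lemma coord_snd_continuous i :
  continuous (fun p : posvec R d * posvec R d => coord p.2 i).
Proof.
move=> p; apply: (@continuous_comp _ _ _ snd (fun x => coord x i)).
  exact: cvg_snd.
exact: coord_posvec_continuous.
Qed.

Lemma ggg_coord x y : (forall i, coord y i < coord x i) -> ggg x y.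
Proof.
(* The partial sum up to [k] contains the index [k], whose term supplies the strictness. *)
move=> yx k; rewrite (bigD1 k)//= [ltRHS](bigD1 k)//= ltr_leD//.
by apply: ler_sum => i _; exact: ltW.
Qed.

(** Finitely many strict inequalities between continuous partial sums persist nearby. *)
Lemma ggg_open : open [set p : posvec R d * posvec R d | ggg p.1 p.2].
Proof.
rewrite openE => p pgt; apply: (filter_forall (nbhs_filter p)) => k.
apply: (near_lt_fun (f := fun q => \sum_(i < d | (i <= k)%N) coord q.2 i)
  (g := fun q => \sum_(i < d | (i <= k)%N) coord q.1 i) _ _ (pgt k));
  apply: continuous_big.
- exact: add_continuous.
- by move=> i _; exact: coord_snd_continuous.
- exact: add_continuous.
- by move=> i _; exact: coord_fst_continuous.
Qed.

Lemma gt_sym_coord x y : (forall i, coord y i < coord x i) -> gt_sym x y.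
Proof. by move=> yx; exists 1%g => i; rewrite perm1. Qed.

Lemma gt_sym_open : open [set p : posvec R d * posvec R d | gt_sym p.1 p.2].
Proof.
rewrite openE => p [s ps].
(* The permutation found at [p] serves at all nearby pairs. *)
suff : \forall q \near p, forall i, coord q.2 i < coord q.1 (s i).
  by apply: filterS => q qs; exists s.
apply: (filter_forall (nbhs_filter p)) => i.
apply: (near_lt_fun (f := fun q => coord q.2 i)
  (g := fun q => coord q.1 (s i)) _ _ (ps i)).
  exact: coord_snd_continuous.
exact: coord_fst_continuous.
Qed.

End positive_vectors.

Theorem corollary7 (R : realType) (d : nat) (hd : (2 <= d)%N) :
  [/\ locally_compact [set: posvec R d],
      separable (posvec R d)
    & completely_metrizable R (posvec R d)] /\
  (closed_in_closed_convergence
     (grodal_monotone_preferences (@ggg R d)) /\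
   grodal_monotone_preferences (@ggg R d) `<=`
     [set F | locally_strict F]) /\
  (closed_in_closed_convergence
     (grodal_monotone_preferences (@gt_sym R d)) /\
   grodal_monotone_preferences (@gt_sym R d) `<=`
     [set F | locally_strict F]).
Proof.
split; first split.
- exact: posvec_locally_compact.
- exact: posvec_separable.
- exact: posvec_completely_metrizable.
split; first exact: dominance_class (@ggg_coord R d) (@ggg_open R d).
exact: dominance_class (@gt_sym_coord R d) (@gt_sym_open R d).
Qed.
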